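(* The set $\mathrm{Mat}_p:=\mathrm{Mat}/\sim_p$ of equivalence classes of all real square matrices under permutation similarity is a commutative semiring with addition $\oplus$ (direct sum) and multiplication $\boxplus$ (Kronecker sum). Its zero element is the equivalence class of the empty ($0\times0$) matrix $(\ )$, and the neutral multiplicative element is the equivalence class of the $1\times1$ matrix $(0)$.
   Context: $\mathrm{Mat}=\bigsqcup_{q\ge0}\mathbb R^{q\times q}$ is the set of all real square matrices. Two $q\times q$ matrices $B,C$ are permutation similar, $B\sim_pC$, if $C=P^{-1}BP$ for some permutation matrix $P$. $A\oplus B$ is the block diagonal matrix with diagonal blocks $A,B$. For $A\in\mathbb R^{n\times n}$, $B\in\mathbb R^{m\times m}$, the Kronecker sum is $A\boxplus B=A\otimes I_m+I_n\otimes B$, where $\otimes$ is the Kronecker product and $I_k$ the $k\times k$ identity matrix. Operations on equivalence classes are performed on representatives. A commutative semiring is a set with two commutative, associative operations $+,\cdot$ with neutral elements $0$ and $1$, such that $\cdot$ distributes over $+$ and $0\cdot x=0$ for all $x$. *)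

(* Defs.v *)
From HB Require Import structures.
From mathcomp Require Import all_boot all_order all_fingroup all_algebra.
From mathcomp Require Import generic_quotient.
From mathcomp Require Import mxtens.
From mathcomp Require Import boolp reals.

Set Implicit Arguments.
Unset Strict Implicit.
Unset Printing Implicit Defensive.

Import GRing.Theory.
Local Open Scope ring_scope.
Local Open Scope quotient_scope.

Definition Mat (R : realType) := {q : nat & 'M[R]_q}.

Definition mat (R : realType) (q : nat) (A : 'M[R]_q) : Mat R :=
  Tagged (fun q => 'M[R]_q) A.

Definition perm_similar (R : realType) (q : nat) (B C : 'M[R]_q) : Prop :=
  exists2 P : 'M[R]_q, is_perm_mx P & C = invmx P *m B *m P.

Definition Mat_sim (R : realType) (X Y : Mat R) : Prop :=
  exists (q : nat) (B C : 'M[R]_q),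
    [/\ X = mat B, Y = mat C & perm_similar B C].

Definition Mat_simb (R : realType) : rel (Mat R) :=
  fun X Y => `[< Mat_sim X Y >].

Lemma is_perm_mx_unit (R : realType) (q : nat) (P : 'M[R]_q) :
  is_perm_mx P -> P \in unitmx.
Proof. by case/is_perm_mxP=> s ->; exact: unitmx_perm. Qed.

Lemma is_perm_mx_inv (R : realType) (q : nat) (P : 'M[R]_q) :
  is_perm_mx P -> is_perm_mx (invmx P).
Proof.
move=> hP; have uP := is_perm_mx_unit hP.
by rewrite -(is_perm_mxMl _ hP) mulmxV // is_perm_mx1.
Qed.

Lemma Mat_simb_refl (R : realType) : reflexive (@Mat_simb R).
Proof.
case=> q A; apply/asboolP; exists q, A, A; split=> //.
by exists 1%:M; rewrite ?is_perm_mx1 // invmx1 mul1mx mulmx1.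
Qed.

Lemma Mat_sim_sym (R : realType) (X Y : Mat R) : Mat_sim X Y -> Mat_sim Y X.
Proof.
case=> q [B [C [-> -> [P hP ->]]]].
exists q, (invmx P *m B *m P), B; split=> //.
exists (invmx P); first exact: is_perm_mx_inv.
have uP := is_perm_mx_unit hP.
by rewrite invmxK !mulmxA mulmxV // mul1mx mulmxK.
Qed.

Lemma Mat_simb_sym (R : realType) : symmetric (@Mat_simb R).
Proof. by move=> X Y; apply/asboolP/asboolP; exact: Mat_sim_sym. Qed.

Lemma Mat_simb_trans (R : realType) : transitive (@Mat_simb R).
Proof.
move=> Y X Z /asboolP[q [B [C [-> -> [P hP eC]]]]].
move=> /asboolP[q' [C' [D [eY -> [P' hP' eD]]]]].
apply/asboolP.
have eq : q = q' by have := congr1 tag eY.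
subst q'; have eCC : C = C' := eq_from_Tagged eY.
subst C'; exists q, B, D; split=> //; exists (P *m P').
  by rewrite is_perm_mxMl.
rewrite eD eC -!mulmxA.
suff -> : invmx (P *m P') = invmx P' *m invmx P by rewrite !mulmxA.
have uP := is_perm_mx_unit hP; have uP' := is_perm_mx_unit hP'.
have uPP : P *m P' \in unitmx by rewrite unitmx_mul uP.
by rewrite -[RHS](mulmxK uPP) mulmxA mulmxKV // mulVmx // mul1mx.
Qed.

Canonical Mat_sim_equiv (R : realType) : equiv_rel (Mat R) :=
  EquivRel (@Mat_simb R) (@Mat_simb_refl R) (@Mat_simb_sym R)
           (@Mat_simb_trans R).

Definition Matp (R : realType) := {eq_quot (Mat_sim_equiv R)}.
HB.instance Definition _ (R : realType) := Choice.on (Matp R).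
HB.instance Definition _ (R : realType) := EqQuotient.on (Matp R).

Definition mat_class (R : realType) (X : Mat R) : Matp R := \pi_(Matp R) X.

Definition dsum (R : realType) (X Y : Mat R) : Mat R :=
  mat (block_mx (tagged X) 0 0 (tagged Y)).

Definition kronsum_mx (R : realType) (n m : nat) (A : 'M[R]_n) (B : 'M[R]_m) :
    'M[R]_(n * m) :=
  A *t (1%:M : 'M[R]_m) + (1%:M : 'M[R]_n) *t B.

Definition kronsum (R : realType) (X Y : Mat R) : Mat R :=
  mat (kronsum_mx (tagged X) (tagged Y)).

(* These act on the canonical representatives chosen by [repr]; by themselves
   they do not assert independence of the choice of representatives. *)
Definition Matp_add (R : realType) (x y : Matp R) : Matp R :=
  mat_class (dsum (repr x) (repr y)).

Definition Matp_mul (R : realType) (x y : Matp R) : Matp R :=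
  mat_class (kronsum (repr x) (repr y)).

Definition Matp_zero (R : realType) : Matp R := mat_class (mat (0 : 'M[R]_0)).

Definition Matp_one (R : realType) : Matp R := mat_class (mat (0 : 'M[R]_1)).

(* Additive inverses are not required, and [one <> zero] is not assumed. *)
Record comm_semiring (T : Type) (add mul : T -> T -> T) (zero one : T) :
    Prop := CommSemiring {
  comm_semiring_addC : commutative add;
  comm_semiring_addA : associative add;
  comm_semiring_add0 : left_id zero add;
  comm_semiring_mulC : commutative mul;
  comm_semiring_mulA : associative mul;
  comm_semiring_mul1 : left_id one mul;
  comm_semiring_mulDl : left_distributive mul add;
  comm_semiring_mul0 : left_zero zero mul
}.

(* Main.v *)
Require Import Defs.
From mathcomp Require Import all_boot all_algebra reals.
From mathcomp Require Import perm generic_quotient mxtens boolp.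

Import GRing.Theory.
Local Open Scope ring_scope.
Local Open Scope quotient_scope.

(** Permutation similarity says that only the labelling of rows and columns is
    forgotten, so a class in [Matp] is a square array indexed by an arbitrary
    finite label set, taken up to bijections of label sets.  From that point of
    view, [dsum] lives on the disjoint union [I + J] of the label sets and
    [kronsum] on their cartesian product [I * J], the entry at
    [((i, j), (i', j'))] being [a i i'] if [j = j'], plus [b j j'] if [i = i'].
    The block and tensor matrices merely transport these arrays along the
    standard bijections ['I_n + 'I_m -> 'I_(n + m)] and
    ['I_n * 'I_m -> 'I_(n * m)].

    Each semiring law then becomes one of the canonical bijections between
    sums and products of sets (swapping, reassociating, distributing, dropping
    an empty summand or a one-point factor), together with a check that it
    preserves entries.  Independence of representatives holds because sums and
    products of bijections are bijections.  The equivalence between equality of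
    classes and relabelling is [mat_class_eqP]; the two transports are
    [dsum_relabeled] and [kronsum_relabeled]. *)

(** * Arrays up to relabelling *)

Definition relabeled {R I J : Type} (a : I -> I -> R)
    (b : J -> J -> R) : Prop :=
  exists2 f : I -> J, bijective f & forall i i', a i i' = b (f i) (f i').

Lemma relabeled_sym {R I J : Type} (a : I -> I -> R) (b : J -> J -> R) :
  relabeled a b -> relabeled b a.
Proof.
case=> f [g fK gK] ab; exists g; first by exists f.
by move=> j j'; rewrite ab !gK.
Qed.

Lemma relabeled_trans {R I J K : Type} {a : I -> I -> R} (b : J -> J -> R)
    {c : K -> K -> R} :
  relabeled a b -> relabeled b c -> relabeled a c.
Proof.
case=> f fbij ab [g gbij bc]; exists (g \o f); first exact: bij_comp.
by move=> i i'; rewrite ab bc.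
Qed.

Lemma relabeled_refl {R I : Type} (a : I -> I -> R) : relabeled a a.
Proof. by exists id => //; exists id. Qed.

(** A bijection between ordinals forces the two dimensions to agree, so that
    it is a permutation [s]; conjugation by the permutation matrix of [s] then
    turns the entry at [(i, j)] into the entry at their preimages under [s]. *)
Lemma mat_class_eqP {R : realType} (X Y : Mat R) :
  mat_class X = mat_class Y <-> relabeled (tagged X) (tagged Y).
Proof.
have conjE q (B : 'M[R]_q) (s : {perm 'I_q}) i j :
    (invmx (perm_mx s) *m B *m perm_mx s) i j = B (s^-1 i)%g (s^-1 j)%g.
  have -> : invmx (perm_mx s) = perm_mx s^-1 :> 'M[R]_q.
    rewrite -[RHS](mulmxK (unitmx_perm R s)) -perm_mxM mulVg perm_mx1.
    by rewrite mul1mx.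
  by rewrite -row_permE -{2}[s]invgK -col_permE !mxE.
split=> [/eqquotP/asboolP[q [B [C [-> -> [_ /is_perm_mxP[s ->] ->]]]]] | ].
  exists s; first by exists (s^-1)%g; [exact: permK | exact: permKV].
  by move=> i j; rewrite /= conjE !permK.
case: X Y => [q A] [p B] /= [f fbij AB]; apply/eqquotP/asboolP.
have eqp : q = p by have := bij_eq_card fbij; rewrite !card_ord.
subst p; exists q, A, B; split=> //.
have finj := bij_inj fbij.
exists (perm_mx (perm finj)); first exact: perm_mx_is_perm.
by apply/matrixP=> i j; rewrite conjE AB -!(permE finj) !permKV.
Qed.

(** * Direct and Kronecker sums of arrays *)

Definition sum_array {R : nmodType} {I J : Type} (a : I -> I -> R)
    (b : J -> J -> R) (x y : I + J) : R :=
  match x, y with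
  | inl i, inl i' => a i i'
  | inr j, inr j' => b j j'
  | _, _ => 0
  end.

(** The Kronecker deltas stand for the identity matrices of the Kronecker sum;
    as multiplicities they need only addition on [R]. *)
Definition kron_array {R : nmodType} {I J : eqType} (a : I -> I -> R)
    (b : J -> J -> R) (x y : I * J) : R :=
  a x.1 y.1 *+ (x.2 == y.2) + b x.2 y.2 *+ (x.1 == y.1).

Lemma sum_array_relabeled {R : nmodType} {I J I' J' : Type} {a : I -> I -> R}
    {b : J -> J -> R} {a' : I' -> I' -> R} {b' : J' -> J' -> R} :
  relabeled a a' -> relabeled b b' ->
  relabeled (sum_array a b) (sum_array a' b').
Proof.
case=> f [f' fK f'K] aE [g [g' gK g'K] bE].
exists (fun x => match x with inl i => inl (f i) | inr j => inr (g j) end).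
  exists (fun x => match x with inl i => inl (f' i) | inr j => inr (g' j) end).
    by case=> i; rewrite ?fK ?gK.
  by case=> i; rewrite ?f'K ?g'K.
by move=> [i|i] [j|j] /=.
Qed.

Lemma kron_array_relabeled {R : nmodType} {I J I' J' : eqType} {a : I -> I -> R}
    {b : J -> J -> R} {a' : I' -> I' -> R} {b' : J' -> J' -> R} :
  relabeled a a' -> relabeled b b' ->
  relabeled (kron_array a b) (kron_array a' b').
Proof.
case=> f fbij aE [g gbij bE].
case: (fbij) (gbij) => [f' fK f'K] [g' gK g'K].
exists (fun x => (f x.1, g x.2)).
  by exists (fun x => (f' x.1, g' x.2)) => -[i j] /=; rewrite ?fK ?gK ?f'K ?g'K.
by move=> x y; rewrite /kron_array /= aE bE !(bij_eq fbij, bij_eq gbij).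
Qed.

(** * The semiring laws for arrays *)

Lemma sum_arrayC {R : nmodType} {I J : Type} (a : I -> I -> R)
    (b : J -> J -> R) :
  relabeled (sum_array a b) (sum_array b a).
Proof.
exists (fun x => match x with inl i => inr i | inr j => inl j end).
  by exists (fun x => match x with inl i => inr i | inr j => inl j end); case.
by move=> [i|i] [j|j].
Qed.

Lemma sum_arrayA {R : nmodType} {I J K : Type} (a : I -> I -> R)
    (b : J -> J -> R) (c : K -> K -> R) :
  relabeled (sum_array a (sum_array b c)) (sum_array (sum_array a b) c).
Proof.
exists (fun x => match x with
  | inl i => inl (inl i) | inr (inl j) => inl (inr j) | inr (inr k) => inr k
  end).
  exists (fun x => match x with
    | inl (inl i) => inl i | inl (inr j) => inr (inl j) | inr k => inr (inr k)
    end); by [case=> [|[]] | case=> [[]|]].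
by move=> [i|[i|i]] [j|[j|j]].
Qed.

Lemma sum_array0 {R : nmodType} {I J : Type} (a : I -> I -> R)
    (b : J -> J -> R) :
  (I -> False) -> relabeled b (sum_array a b).
Proof.
move=> I0; exists inr => //.
exists (fun x => match x with
  | inl i => False_rect J (I0 i) | inr j => j
  end) => //.
by case=> // i; case: (I0 i).
Qed.

Lemma kron_arrayC {R : nmodType} {I J : eqType} (a : I -> I -> R)
    (b : J -> J -> R) :
  relabeled (kron_array a b) (kron_array b a).
Proof.
exists (fun x => (x.2, x.1)); first by exists (fun x => (x.2, x.1)); case.
by move=> x y; rewrite /kron_array addrC.
Qed.

(** Bracketing either way, the entry at two triples is the sum over the three
    positions of the entry of the corresponding factor, present when the triples
    agree at the other two positions. *)
Lemma kron_arrayA {R : nmodType} {I J K : eqType} (a : I -> I -> R)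
    (b : J -> J -> R) (c : K -> K -> R) :
  relabeled (kron_array a (kron_array b c)) (kron_array (kron_array a b) c).
Proof.
exists (fun x => ((x.1, x.2.1), x.2.2)).
  by exists (fun x => (x.1.1, (x.1.2, x.2))); [case=> i [] | case=> [[]]].
move=> [i [j k]] [i' [j' k']]; rewrite /kron_array /= !xpair_eqE.
rewrite !mulrnDl -!mulrnA !mulnb addrA [(k == _) && _]andbC.
by rewrite [(j == _) && (i == _)]andbC.
Qed.

Lemma kron_array1 {R : nmodType} {J : eqType} (b : J -> J -> R) :
  relabeled (kron_array (fun _ _ : 'I_1 => 0) b) b.
Proof.
exists snd; first by exists (pair ord0) => // -[i j]; rewrite [i]ord1.
by move=> [i j] [i' j']; rewrite /kron_array /= !ord1 mul0rn add0r.
Qed.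

Lemma kron_sum_arrayDl {R : nmodType} {I J K : eqType} (a : I -> I -> R)
    (b : J -> J -> R) (c : K -> K -> R) :
  relabeled (kron_array (sum_array a b) c)
            (sum_array (kron_array a c) (kron_array b c)).
Proof.
exists (fun x => match x.1 with
  | inl i => inl (i, x.2) | inr j => inr (j, x.2)
  end).
  exists (fun x => match x with
    | inl y => (inl y.1, y.2) | inr y => (inr y.1, y.2)
    end); by [case=> [[]] | case=> [[]|[]]].
(* Entries coupling the two summands vanish: the labels differ, so the
   contribution of [c] is absent. *)
by move=> [[i|i] k] [[j|j] l]; rewrite /kron_array //= mul0rn mulr0n addr0.
Qed.

Lemma kron_array0 {R : nmodType} {I J K : eqType} (a : I -> I -> R)
    (b : J -> J -> R) (c : K -> K -> R) :
  (I -> False) -> (K -> False) -> relabeled (kron_array a b) c.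
Proof.
move=> I0 K0; exists (fun x => False_rect K (I0 x.1)).
  exists (fun k => False_rect _ (K0 k)) => [[i]|k].
    by case: (I0 i).
  by case: (K0 k).
by case=> i; case: (I0 i).
Qed.

(** * The quotient *)

(** The form in which identities of classes are proved: two matrices built from
    [dsum] and [kronsum] are compared through arrays [a] and [b] that describe
    them, whose label sets are sums and products rather than ordinals. *)
Lemma mat_class_eq_via {R : realType} {I J : Type} {X Y : Mat R}
    (a : I -> I -> R) (b : J -> J -> R) :
  relabeled a (tagged X) -> relabeled b (tagged Y) -> relabeled a b ->
  mat_class X = mat_class Y.
Proof.
move=> aX bY ab; apply/mat_class_eqP.
exact: relabeled_trans (relabeled_sym _ _ aX) (relabeled_trans _ ab bY).
Qed.

Lemma dsum_relabeled {R : realType} {I J : Type} {a : I -> I -> R}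
    {b : J -> J -> R} {X Y : Mat R} :
  relabeled a (tagged X) -> relabeled b (tagged Y) ->
  relabeled (sum_array a b) (tagged (dsum X Y)).
Proof.
move=> aX bY; apply: relabeled_trans (sum_array_relabeled aX bY) _.
exists unsplit; first by exists split; [exact: unsplitK | exact: splitK].
by move=> [i|i] [j|j] /=;
  rewrite ?block_mxEul ?block_mxEur ?block_mxEdl ?block_mxEdr ?mxE.
Qed.

Lemma kronsum_relabeled {R : realType} {I J : eqType} {a : I -> I -> R}
    {b : J -> J -> R} {X Y : Mat R} :
  relabeled a (tagged X) -> relabeled b (tagged Y) ->
  relabeled (kron_array a b) (tagged (kronsum X Y)).
Proof.
move=> aX bY; apply: relabeled_trans (kron_array_relabeled aX bY) _.
exists (@mxtens_index _ _).
  exists (@mxtens_unindex _ _); first exact: mxtens_indexK.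
  exact: mxtens_unindexK.
move=> [i j] [i' j'] /=; rewrite /kronsum_mx mxE !tensmxE !mxE.
by rewrite mulr_natr mulr_natl.
Qed.

Lemma relabeled_repr {R : realType} (X : Mat R) :
  relabeled (tagged X) (tagged (repr (mat_class X))).
Proof. by apply/mat_class_eqP; rewrite /mat_class reprK. Qed.

Lemma Matp_addE {R : realType} (X Y : Mat R) :
  Matp_add (mat_class X) (mat_class Y) = mat_class (dsum X Y).
Proof.
apply: mat_class_eq_via (relabeled_refl _).
  exact: dsum_relabeled (relabeled_repr X) (relabeled_repr Y).
exact: dsum_relabeled (relabeled_refl _) (relabeled_refl _).
Qed.

Lemma Matp_mulE {R : realType} (X Y : Mat R) :
  Matp_mul (mat_class X) (mat_class Y) = mat_class (kronsum X Y).
Proof.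
apply: mat_class_eq_via (relabeled_refl _).
  exact: kronsum_relabeled (relabeled_repr X) (relabeled_repr Y).
exact: kronsum_relabeled (relabeled_refl _) (relabeled_refl _).
Qed.

Theorem proposition19 (R : realType) :
  [/\ forall X Y : Mat R,
        Matp_add (mat_class X) (mat_class Y) = mat_class (dsum X Y),
      forall X Y : Mat R,
        Matp_mul (mat_class X) (mat_class Y) = mat_class (kronsum X Y)
    & comm_semiring (@Matp_add R) (@Matp_mul R) (Matp_zero R) (Matp_one R)].
Proof.
split; [exact: Matp_addE | exact: Matp_mulE |].
have lift x : exists X : Mat R, x = mat_class X.
  by exists (repr x); rewrite /mat_class reprK.
have E (X : Mat R) : relabeled (tagged X) (tagged X) := relabeled_refl _.
have I0 : 'I_0 -> False by case.
split.
- move=> x y; have [[X ->] [Y ->]] := (lift x, lift y); rewrite !Matp_addE.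
  exact: mat_class_eq_via
    (dsum_relabeled (E X) (E Y)) (dsum_relabeled (E Y) (E X)) (sum_arrayC _ _).
- move=> x y z; have [[X ->] [Y ->] [Z ->]] := And3 (lift x) (lift y) (lift z).
  rewrite !Matp_addE.
  exact: mat_class_eq_via
    (dsum_relabeled (E X) (dsum_relabeled (E Y) (E Z)))
    (dsum_relabeled (dsum_relabeled (E X) (E Y)) (E Z)) (sum_arrayA _ _ _).
- move=> x; have [X ->] := lift x; rewrite Matp_addE.
  exact: mat_class_eq_via (dsum_relabeled (E (mat 0)) (E X)) (E X)
    (relabeled_sym _ _ (sum_array0 _ _ I0)).
- move=> x y; have [[X ->] [Y ->]] := (lift x, lift y); rewrite !Matp_mulE.
  exact: mat_class_eq_via
    (kronsum_relabeled (E X) (E Y)) (kronsum_relabeled (E Y) (E X))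
    (kron_arrayC _ _).
- move=> x y z; have [[X ->] [Y ->] [Z ->]] := And3 (lift x) (lift y) (lift z).
  rewrite !Matp_mulE.
  exact: mat_class_eq_via
    (kronsum_relabeled (E X) (kronsum_relabeled (E Y) (E Z)))
    (kronsum_relabeled (kronsum_relabeled (E X) (E Y)) (E Z)) (kron_arrayA _ _ _).
- move=> x; have [X ->] := lift x; rewrite Matp_mulE.
  have zero1 : relabeled (fun _ _ : 'I_1 => 0) (tagged (mat (0 : 'M[R]_1))).
    by exists id; [exists id | move=> i j; rewrite mxE].
  exact: mat_class_eq_via (kronsum_relabeled zero1 (E X)) (E X)
    (kron_array1 _).
- move=> x y z; have [[X ->] [Y ->] [Z ->]] := And3 (lift x) (lift y) (lift z).
  rewrite !(Matp_addE, Matp_mulE).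
  exact: mat_class_eq_via
    (kronsum_relabeled (dsum_relabeled (E X) (E Y)) (E Z))
    (dsum_relabeled (kronsum_relabeled (E X) (E Z))
                    (kronsum_relabeled (E Y) (E Z)))
    (kron_sum_arrayDl _ _ _).
- move=> x; have [X ->] := lift x; rewrite Matp_mulE.
  exact: mat_class_eq_via (kronsum_relabeled (E (mat 0)) (E X)) (E (mat 0))
    (kron_array0 _ _ _ I0 I0).
Qed.
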